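(* Let $x^n=(x_0^n,\dots,x_M^n)\in\mathcal Q$ be the solution to the fully discrete scheme (S) of the context at time $t^n$, with positive initial state $u_0$. Denote $E_N^n:=E_N(x^n)$, where $E_N:\mathcal Q\to\mathbb{R}$ is the discrete total energy $$E_N(x):=\Big\langle H\Big(\frac{u_0}{D_hx}\Big),D_hx\Big\rangle_{\mathcal C}+\langle u_0,V(x)\rangle_{\mathcal E}+\frac12\big\langle u_0,\langle W(x-y),u_0\rangle_{\mathcal E}\big\rangle_{\mathcal E},$$ in whose last term $y$ denotes the same trajectory $x$ as a function of a second grid variable $Y$ (the inner bracket is over $Y$, the outer one over $X$). Then the discrete energy dissipation law holds, i.e., for $n=0,1,\dots$ $$\frac{E_N^{n+1}-E_N^n}{\tau}\le-\Big\langle\frac{u_0^2}{\widetilde D_hx^n}\cdot\frac1{f\big(\frac{u_0}{\widetilde D_hx^n}\big)}\cdot\frac{x^{n+1}-x^n}{\tau},\frac{x^{n+1}-x^n}{\tau}\Big\rangle_{\mathcal E}\le0 .$$ This is the discrete counterpart of the continuous dissipation law $\frac{d}{dt}E^{total}=-\int_\Omega\frac{u^2}{f(u)}|\mathbf v|^2dx$, where $E^{total}=\int_{\Omega}[H(u)+uV(x)]dx+\frac12\int_{\Omega}\int_{\Omega}W(x-y)u(x)u(y)\,dy\,dx$ and $\mathbf v=-\frac{f(u)}{u}\partial_x[H'(u)+V(x)+W*u]$.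
   Context: Let $\Omega\subset\mathbb{R}$ be a bounded interval with left endpoint $X_0$, $M\in\mathbb{N}^+$, $h=|\Omega|/M$, $X_r=X_0+rh$ for integer or half-integer $r$, and $\tau>0$ the time step, $t^n=n\tau$. $\mathcal E_M$ and $\mathcal C_M$ denote the spaces of grid functions on $\{X_i: 0\le i\le M\}$ and $\{X_{i-1/2}:1\le i\le M\}$, respectively. Difference operators: $(D_hl)_{i-1/2}=(l_i-l_{i-1})/h$, $1\le i\le M$; $(d_h\phi)_i=(\phi_{i+1/2}-\phi_{i-1/2})/h$, $1\le i\le M-1$; $(\widetilde D_hl)_i=(l_{i+1}-l_{i-1})/(2h)$ for $1\le i\le M-1$, $(\widetilde D_hl)_0=(l_1-l_0)/h$, $(\widetilde D_hl)_M=(l_M-l_{M-1})/h$. Inner products: $\langle l,g\rangle_{\mathcal E}=h\big(\frac12l_0g_0+\sum_{i=1}^{M-1}l_ig_i+\frac12l_Mg_M\big)$ and $\langle\phi,\varphi\rangle_{\mathcal C}=h\sum_{i=0}^{M-1}\phi_{i+1/2}\varphi_{i+1/2}$. The admissible set is $\mathcal Q=\{l\in\mathcal E_M: l_{i-1}<l_i,\ 1\le i\le M;\ l_0=X_0,\ l_M=X_M\}$. Data: $u_0$ is the initial density, with values at nodes and half points; $H:[0,\infty)\to\mathbb{R}$ with $H''>0$; $f:[0,\infty)\to[0,\infty)$ increasing and differentiable with $f(0)=0$, $f'(0)\ne0$; $V$ is an external potential and $W$ an even Lipschitz continuous function, split as $V=V_c-V_e$ and $W=W_c-W_e$, where $V_c,V_e,W_c,W_e$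 are convex functions. In the continuous law, $u(x,t)$ is the density with initial value $u_0$ solving $\partial_tu+\partial_x(u\mathbf v)=0$ with zero flux on $\partial\Omega$, and $(W*u)(x,t)=\int_\Omega W(x-y)u(y,t)dy$. Fully discrete scheme (S): $x^0=X$ (i.e. $x_i^0=X_i$); given $x^n\in\mathcal Q$, find $x^{n+1}\in\mathcal Q$ (so $x_0^{n+1}=X_0$, $x_M^{n+1}=X_M$) such that for $1\le i\le M-1$ $$\frac{u_{0,i}^2}{(\widetilde D_hx^n)_i}\cdot\frac1{f\big(\frac{u_{0,i}}{(\widetilde D_hx^n)_i}\big)}\cdot\frac{x_i^{n+1}-x_i^n}{\tau}=-d_h\Big[\frac{u_0}{D_hx^{n+1}}H'\Big(\frac{u_0}{D_hx^{n+1}}\Big)-H\Big(\frac{u_0}{D_hx^{n+1}}\Big)\Big]_i-u_{0,i}V_c'(x_i^{n+1})+u_{0,i}V_e'(x_i^n)-u_{0,i}\hat{\mathcal S}_{c,i}^{n+1}+u_{0,i}\hat{\mathcal S}_{e,i}^n,$$ where $u_{0,i}=u_0(X_i)$, expressions involving $u_0/D_hx$ are evaluated at half points, and $\hat{\mathcal S}_{c,i}^{n+1}=\langle W_c'(x_i^{n+1}-x^{n+1}),u_0\rangle_{\mathcal E}$, $\hat{\mathcal S}_{e,i}^{n}=\langle W_e'(x_i^{n}-x^{n}),u_0\rangle_{\mathcal E}$ (the inner product taken over the grid variable of the second occurrence of $x$).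
   Formalization: The formal theorem additionally assumes that W_c (hence also W_e, since W is even) is even; for a convex splitting of W into non-even functions the discrete energy can increase, so the law fails as stated. *)

(* Defs.v *)
From HB Require Import structures.
From mathcomp Require Import all_boot all_order all_algebra.
From mathcomp Require Import all_classical all_reals all_analysis.
Set Implicit Arguments.
Unset Strict Implicit.
Unset Printing Implicit Defensive.
Import Order.TTheory GRing.Theory Num.Theory.
Import numFieldNormedType.Exports.
Local Open Scope classical_set_scope.
Local Open Scope ring_scope.

(* Omega = (a, b) is cut into M cells.  A grid function is a function
   nat -> R, read only on its grid: [l i] is the value l_i at the node X_i for
   0 <= i <= M, and [phi k] is the value phi_{k+1/2} at the half point
   X_{k+1/2} for 0 <= k < M. *)

Definition mesh (R : realType) (a b : R) (M : nat) : R := (b - a) / M%:R.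

Definition grid_point (R : realType) (a b : R) (M : nat) (r : R) : R :=
  a + r * mesh a b M.

Definition at_nodes (R : realType) (a b : R) (M : nat) (g : R -> R) : nat -> R :=
  fun i => g (grid_point a b M i%:R).

Definition at_halves (R : realType) (a b : R) (M : nat) (g : R -> R) : nat -> R :=
  fun k => g (grid_point a b M (k%:R + 2^-1)).

(* From nodes to half points: (D_h l)_{k+1/2}, 0 <= k < M. *)
Definition Dh (R : realType) (a b : R) (M : nat) (l : nat -> R) : nat -> R :=
  fun k => (l k.+1 - l k) / mesh a b M.

(* From half points to interior nodes: (d_h phi)_i, 1 <= i <= M-1. *)
Definition dh (R : realType) (a b : R) (M : nat) (phi : nat -> R) : nat -> R :=
  fun i => (phi i - phi i.-1) / mesh a b M.

(* From nodes to nodes: one-sided at i = 0 and i = M, centered in between. *)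
Definition Dtilde (R : realType) (a b : R) (M : nat) (l : nat -> R) : nat -> R :=
  fun i =>
    if i == 0%N then (l 1%N - l 0%N) / mesh a b M
    else if i == M then (l M - l M.-1) / mesh a b M
    else (l i.+1 - l i.-1) / (2 * mesh a b M).

Definition innerE (R : realType) (a b : R) (M : nat) (l g : nat -> R) : R :=
  mesh a b M * (2^-1 * l 0%N * g 0%N + \sum_(1 <= i < M) l i * g i
                + 2^-1 * l M * g M).

Definition innerC (R : realType) (a b : R) (M : nat) (phi psi : nat -> R) : R :=
  mesh a b M * \sum_(0 <= k < M) phi k * psi k.

Definition admissible (R : realType) (a b : R) (M : nat) (l : nat -> R) : Prop :=
  [/\ forall i, (1 <= i <= M)%N -> l i.-1 < l i,
      l 0%N = grid_point a b M 0 &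
      l M = grid_point a b M M%:R].

(* H'' > 0; only s > 0 is required, so that H(s) = s ln s is covered. *)
Definition positive_second_derivative (R : realType) (H : R -> R) : Prop :=
  forall s : R, 0 < s ->
    [/\ derivable H s 1, derivable (derive1 H) s 1 & 0 < derive1n 2 H s].

(* f : [0, oo[ -> [0, oo[; its derivative at 0 is the right derivative. *)
Definition mobility (R : realType) (f : R -> R) : Prop :=
  [/\ forall s : R, 0 <= s -> 0 <= f s,
      forall s t : R, 0 <= s -> s <= t -> f s <= f t,
      forall s : R, 0 < s -> derivable f s 1,
      f 0 = 0 &
      exists2 f'0 : R, f'0 != 0 &
        (f s - f 0) / s @[s --> 0^'+] --> f'0].

(* Convex on the closed interval [c, d], with a derivative inside it: the
   scheme evaluates V_c', V_e', W_c', W_e' at interior points only. *)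
Definition convex_derivable (R : realType) (c d : R) (g : R -> R) : Prop :=
  convex_function (E := R^o) [set` `[c, d]] g /\
  {in `]c, d[, forall z : R, derivable g z 1}.

(* S^_i = < G'(x_i - x), u_0 >_E, for G = W_c or G = W_e. *)
Definition Shat (R : realType) (a b : R) (M : nat) (u0 G : R -> R)
    (x : nat -> R) (i : nat) : R :=
  innerE a b M (fun j => derive1 G (x i - x j)) (at_nodes a b M u0).

(* u_0^2 / (D~_h x) * 1 / f (u_0 / (D~_h x)), at the nodes. *)
Definition friction (R : realType) (a b : R) (M : nat) (u0 f : R -> R)
    (x : nat -> R) (i : nat) : R :=
  let u0i := at_nodes a b M u0 i in
  u0i ^+ 2 / Dtilde a b M x i * (f (u0i / Dtilde a b M x i))^-1.

(* s H'(s) - H(s) at s = u_0 / (D_h x), at the half points. *)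
Definition pressure (R : realType) (a b : R) (M : nat) (u0 H : R -> R)
    (x : nat -> R) (k : nat) : R :=
  let s := at_halves a b M u0 k / Dh a b M x k in
  s * derive1 H s - H s.

(* One step of the scheme, from x = x^n to y = x^{n+1}. *)
Definition scheme_step (R : realType) (a b : R) (M : nat) (tau : R)
    (u0 H f Vc Ve Wc We : R -> R) (x y : nat -> R) : Prop :=
  forall i, (1 <= i <= M.-1)%N ->
    let u0i := at_nodes a b M u0 i in
    friction a b M u0 f x i * ((y i - x i) / tau) =
      - dh a b M (pressure a b M u0 H y) i
      - u0i * derive1 Vc (y i) + u0i * derive1 Ve (x i)
      - u0i * Shat a b M u0 Wc y i + u0i * Shat a b M u0 We x i.

Definition scheme_solution (R : realType) (a b : R) (M : nat) (tau : R)
    (u0 H f Vc Ve Wc We : R -> R) (x : nat -> nat -> R) : Prop :=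
  [/\ forall i, (i <= M)%N -> x 0%N i = grid_point a b M i%:R,
      forall n, admissible a b M (x n) &
      forall n, scheme_step a b M tau u0 H f Vc Ve Wc We (x n) (x n.+1)].

Definition energy (R : realType) (a b : R) (M : nat) (u0 H V W : R -> R)
    (x : nat -> R) : R :=
  innerC a b M
    (fun k => H (at_halves a b M u0 k / Dh a b M x k)) (Dh a b M x)
  + innerE a b M (at_nodes a b M u0) (fun i => V (x i))
  + 2^-1 * innerE a b M (at_nodes a b M u0)
      (fun i => innerE a b M (fun j => W (x i - x j)) (at_nodes a b M u0)).

(* Main.v *)
(** The entropy term is [sum_k h p_k H(u_k / p_k)] with [p = D_h x]; the
    perspective [p |-> p H(u / p)] of the convex function [H] is convex with
    derivative minus the pressure, so its increment is bounded by the tangent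
    at the new time level, and summation by parts produces [d_h] of the pressure.
    Likewise convex parts ([V_c], [W_c]) are bounded by their tangents at the new
    level and concave parts ([- V_e], [- W_e]) by those at the old one.  Since
    [W_c'] and [W_e'] are odd, symmetrizing the double sum turns
    [1/2 G'(x_i - x_j) (delta_i - delta_j)] into [G'(x_i - x_j) delta_i], and the
    total bound is the right-hand side of the scheme tested against
    [- delta], [delta = x^{n+1} - x^n]. *)

Require Import Defs.
From HB Require Import structures.
From mathcomp Require Import all_boot all_order all_algebra.
From mathcomp Require Import all_classical all_reals all_analysis.
From mathcomp Require Import ring lra.
Set Implicit Arguments.
Unset Strict Implicit.
Unset Printing Implicit Defensive.
Import Order.TTheory GRing.Theory Num.Theory.
Import numFieldNormedType.Exports.
Local Open Scope classical_set_scope.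
Local Open Scope ring_scope.

(** * Tangent-line inequalities and derivatives of even functions *)

Lemma convex_tangent (R : realType) (c d : R) (g : R -> R) (w z : R) :
  convex_derivable c d g -> w \in `]c, d[ -> z \in `[c, d] ->
  g w + derive1 g w * (z - w) <= g z.
Proof.
move=> [cg dg] wcd zcd.
have /derivable1_diffP diffg := dg w wcd.
have dv : derivable g w (z - w) by exact: diff_derivable.
have Dv : 'D_(z - w) g w = derive1 g w * (z - w).
  rewrite deriveE// derive1E'// -[X in 'd g w X = _]mulr1.
  by rewrite [LHS]linearZ mulrC.
rewrite -lerBrDl -Dv.
(* Only right difference quotients along [z - w] are examined: for [0 < t <= 1], convexity between
   [w] and [z] bounds each by [g z - g w]. Since [g] is not differentiated at [z], that point may be
   an endpoint. *)
have /cvg_dnbhs_at_right cv :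
    (fun t => t^-1 *: ((g \o shift w) (t *: (z - w)) - g w)) @ 0^' -->
      'D_(z - w) g w.
  exact: dv.
rewrite -(cvg_lim _ cv)//.
apply: limr_le; first by apply/cvg_ex; eexists; exact: cv.
near=> t.
have t0 : 0 < t by near: t; exact: nbhs_right_gt.
have t1 : t <= 1 by near: t; exact: nbhs_right_le.
rewrite /= ler_pdivrMl//.
have wcd' : w \in [set` `[c, d]] by rewrite inE /=; exact: subset_itv_oo_cc.
have zcd' : z \in [set` `[c, d]] by rewrite inE.
have : g (t * z + (1 - t) * w) <= t * g z + (1 - t) * g w.
  exact: cg (Itv01 (ltW t0) t1) z w zcd' wcd'.
rewrite (_ : t *: (z - w) + w = t * z + (1 - t) * w); first by lra.
by rewrite /GRing.scale /=; ring.
Unshelve. all: by end_near. Qed.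

(** [H'] is nondecreasing on positive reals because [H'' > 0]. The mean value theorem writes the
    increment of [H] with [H' r] for some [r] between [s] and [t], and [H' r] is then compared with
    [H' s]. *)
Lemma derive1_tangent (R : realType) (H : R -> R) (s t : R) :
  positive_second_derivative H -> 0 < s -> 0 < t ->
  H s + derive1 H s * (t - s) <= H t.
Proof.
move=> hH s0 t0.
have dH p : 0 < p -> derivable H p 1 by move=> /hH[].
have ddH p : 0 < p -> derivable (derive1 H) p 1 by move=> /hH[].
have wit (g : R -> R) p q : (forall r, 0 < r -> derivable g r 1) ->
    0 < p -> {within `[p, q], continuous g}.
  move=> dg p0; apply: derivable_within_continuous => r.
  rewrite in_itv/= => /andP[pr _].
  by apply: dg; exact: lt_le_trans pr.
have mono p q : 0 < p -> p <= q -> derive1 H p <= derive1 H q.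
  move=> p0 pq.
  apply: (@ger0_derive1_ndecr _ (derive1 H) p q) => //; last exact: wit.
  - move=> r; rewrite in_itv/= => /andP[pr _]; apply: ddH; exact: lt_trans pr.
  - move=> r; rewrite in_itv/= => /andP[pr _].
    by have [_ _ /ltW] := hH r (lt_trans p0 pr).
have mvt p q : 0 < p -> p <= q ->
    exists2 r, r \in `[p, q] & H q - H p = derive1 H r * (q - p).
  move=> p0 pq; apply: MVT_segment => //; last exact: wit.
  move=> r; rewrite in_itv/= => /andP[pr _].
  by rewrite derive1E; apply/derivableP/dH; exact: lt_trans pr.
have [st|/ltW ts] := leP s t.
  have [r /[!in_itv]/= /andP[sr rt] e] := mvt _ _ s0 st.
  have m := mono _ _ s0 sr.
  by rewrite -lerBrDl e ler_wpM2r// subr_ge0.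
have [r /[!in_itv]/= /andP[tr rs] e] := mvt _ _ t0 ts.
have m := mono _ _ (lt_le_trans t0 tr) rs.
have : derive1 H r * (s - t) <= derive1 H s * (s - t).
  by rewrite ler_wpM2r// subr_ge0.
lra.
Qed.

(** This is the tangent of [H] at [u / p], evaluated at [u / q] and multiplied by [q], since
    [q * (u / q - u / p) = u / p * (p - q)]. *)
Lemma perspective_tangent (R : realType) (H : R -> R) (u p q : R) :
  positive_second_derivative H -> 0 < u -> 0 < p -> 0 < q ->
  H (u / p) * p - (u / p * derive1 H (u / p) - H (u / p)) * (q - p)
    <= H (u / q) * q.
Proof.
move=> hH u0 p0 q0.
have /(ler_wpM2r (ltW q0)) :=
  derive1_tangent hH (divr_gt0 u0 p0) (divr_gt0 u0 q0).
apply: le_trans; rewrite le_eqVlt; apply/orP; left; apply/eqP.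
by field; rewrite !gt_eqF.
Qed.

Lemma derive1_even (R : realType) (c : R) (g : R -> R) (z : R) :
  {in `[- c, c], forall y, g (- y) = g y} ->
  {in `]- c, c[, forall y, derivable g y 1} ->
  z \in `]- c, c[ -> derive1 g (- z) = - derive1 g z.
Proof.
move=> ge dg zc.
have zc' : - z \in `]- c, c[ by move: zc; rewrite !in_itv/=; lra.
have : derive1 (g \o -%R) z = derive1 g z.
  (* Evenness is known on the interval only, so [g] and its reflection are compared near [z]; the
     chain rule then gives the sign. *)
  rewrite !derive1E; apply: near_eq_derive.
  near=> y; rewrite /= ge//; apply: subset_itv_oo_cc.
  by near: y; exact: near_in_itvoo.
have dN : derivable (-%R : R -> R) z 1.
  by apply: derivableN; exact: derivable_id.
rewrite (derive1_comp dN (dg _ zc')).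
rewrite (_ : derive1 -%R z = -1) ?mulrN1; first by move=> <-; rewrite opprK.
rewrite derive1E.
have dN1 : is_derive z 1 (-%R : R -> R) (- 1) by exact: is_deriveN.
exact: (@derive_val _ _ _ _ _ _ _ dN1).
Unshelve. all: by end_near. Qed.

(** * Summation by parts and symmetrization of double sums *)

Lemma sum_by_parts (R : comPzRingType) (P d : nat -> R) (n : nat) : (0 < n)%N ->
  \sum_(0 <= k < n) P k * (d k.+1 - d k) =
  P n.-1 * d n - P 0%N * d 0%N - \sum_(1 <= i < n) (P i - P i.-1) * d i.
Proof.
elim: n => // -[_ _|n IH _].
  by rewrite big_nat1 big_geq// subr0 mulrBr.
rewrite big_nat_recr//= IH//= [in RHS]big_nat_recr//=; ring.
Qed.

(** Exchanging [i] and [j] turns the [d j] half of the double sum into a second copy of the [d i]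
    half. Antisymmetry is asked only after multiplication by [d i], because in the application
    [A i j] is meaningless for some pairs of end nodes, where [d] vanishes. *)
Lemma antisymmetric_double_sum (R : realType) (n : nat) (c d : nat -> R)
    (A : nat -> nat -> R) :
  (forall i j, (i < n)%N -> (j < n)%N -> A j i * d i = - (A i j * d i)) ->
  2^-1 * (\sum_(0 <= i < n) c i * \sum_(0 <= j < n) c j * (A i j * (d i - d j)))
  = \sum_(0 <= i < n) c i * ((\sum_(0 <= j < n) c j * A i j) * d i).
Proof.
move=> Aanti.
set S := RHS.
have eS : S = \sum_(0 <= i < n) \sum_(0 <= j < n) c i * (c j * (A i j * d i)).
  apply: eq_bigr => i _; rewrite mulr_suml mulr_sumr.
  by apply: eq_bigr => j _; rewrite -mulrA.
have eT : - S = \sum_(0 <= i < n) \sum_(0 <= j < n) c i * (c j * (A i j * d j)).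
  rewrite eS [in RHS]exchange_big_nat /= -sumrN.
  apply: eq_big_nat => i /andP[_ ltin].
  rewrite -sumrN; apply: eq_big_nat => j /andP[_ ltjn].
  by rewrite Aanti//; ring.
rewrite (_ : \sum_(0 <= i < n) _ = S - - S); first by field.
rewrite eT {1}eS -sumrB; apply: eq_bigr => i _.
rewrite -sumrB mulr_sumr; apply: eq_bigr => j _; ring.
Qed.

(** * Weighted sums on the grid *)

Section Grid.
Context (R : realType) (a b : R) (hab : a < b) (M : nat) (hM : (0 < M)%N).

Lemma mesh_gt0 : 0 < mesh a b M.
Proof. by rewrite divr_gt0 ?subr_gt0// ltr0n. Qed.

Lemma grid_point_itv (r : R) : 0 <= r <= M%:R -> grid_point a b M r \in `[a, b].
Proof.
move=> /andP[r0 rM]; rewrite in_itv/= /grid_point.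
have h0 := ltW mesh_gt0.
have eb : b = a + M%:R * mesh a b M.
  by rewrite /mesh; field; rewrite pnatr_eq0 -lt0n.
by rewrite lerDl mulr_ge0//= [leRHS]eb lerD2l ler_wpM2r.
Qed.

(** Trapezoidal weights: they turn [innerE] into a single sum, so that inequalities can be proved
    node by node. *)
Definition node_weight (i : nat) : R :=
  mesh a b M * (if (i == 0%N) || (i == M) then 2^-1 else 1).

Lemma node_weight_gt0 i : 0 < node_weight i.
Proof. by rewrite mulr_gt0 ?mesh_gt0//; case: ifP => _; lra. Qed.

Lemma innerE_sum (l g : nat -> R) :
  innerE a b M l g = \sum_(0 <= i < M.+1) node_weight i * (l i * g i).
Proof.
rewrite big_nat_recr//= big_ltn// /innerE /node_weight !eqxx orbT /=.
rewrite !mulrDr mulr_sumr.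
rewrite !mulrA; congr (_ + _ + _).
apply: eq_big_nat => i /andP[i0 iM].
by rewrite gtn_eqF// ltn_eqF//= mulr1 mulrA.
Qed.

Lemma ler_innerE (l g l' g' : nat -> R) :
  (forall i, (i <= M)%N -> l i * g i <= l' i * g' i) ->
  innerE a b M l g <= innerE a b M l' g'.
Proof.
move=> le_lg; rewrite !innerE_sum; apply: ler_sum_nat => i /andP[_ iM].
by rewrite ler_wpM2l ?le_lg// ltW// node_weight_gt0.
Qed.

(** Pairing against the constant [1] gives a common form to products with different factors. *)
Lemma innerED (l g l' g' : nat -> R) :
  innerE a b M l g + innerE a b M l' g' =
  innerE a b M (fun i => l i * g i + l' i * g' i) (fun=> 1).
Proof.
rewrite !innerE_sum -big_split/=; apply: eq_bigr => i _; ring.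
Qed.

Lemma innerEB (l g l' g' : nat -> R) :
  innerE a b M l g - innerE a b M l' g' =
  innerE a b M (fun i => l i * g i - l' i * g' i) (fun=> 1).
Proof.
rewrite !innerE_sum -sumrB; apply: eq_bigr => i _; ring.
Qed.

(** The end nodes do not move, so the boundary terms of the summation by parts vanish, as do the end
    terms of [innerE], where [dh] has no meaning. *)
Lemma dh_by_parts (P x y : nat -> R) : x 0%N = y 0%N -> x M = y M ->
  - innerC a b M P (fun k => Dh a b M y k - Dh a b M x k) =
  innerE a b M (dh a b M P) (fun i => y i - x i).
Proof.
move=> e0 eM; rewrite /innerE e0 eM !subrr !mulr0 addr0 add0r /innerC -mulrN.
congr (_ * _).
have h0 : mesh a b M != 0 by rewrite gt_eqF ?mesh_gt0.
have := sum_by_parts P (fun i => y i - x i) hM.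
rewrite e0 eM !subrr !mulr0 subr0 sub0r => e.
rewrite [LHS](_ : _ = - ((mesh a b M)^-1 *
    \sum_(0 <= k < M) P k * (y k.+1 - x k.+1 - (y k - x k)))); last first.
  rewrite mulr_sumr; congr (- _); apply: eq_bigr => k _.
  by rewrite /Dh; field.
rewrite e mulrN opprK mulr_sumr; apply: eq_bigr => i _.
by rewrite /dh; field.
Qed.

(** * Order and positivity for admissible trajectories *)

Section Admissible.
Context (x : nat -> R) (adm : admissible a b M x).

Lemma admissible_lt i j : (i < j)%N -> (j <= M)%N -> x i < x j.
Proof.
case: adm => inc _ _; elim: j => // j IH.
rewrite ltnS leq_eqVlt => /predU1P[-> jM|ij jM].
  exact: (inc j.+1).
by apply: lt_trans (IH ij (ltnW jM)) _; exact: (inc j.+1).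
Qed.

Lemma admissible0 : x 0%N = a.
Proof. by case: adm => _ -> _; rewrite /grid_point mul0r addr0. Qed.

Lemma admissibleM : x M = b.
Proof.
case: adm => _ _ ->; rewrite /grid_point /mesh.
by field; rewrite pnatr_eq0 -lt0n.
Qed.

Lemma admissible_itvoo i : (0 < i < M)%N -> x i \in `]a, b[.
Proof.
move=> /andP[i0 iM]; rewrite in_itv/= -{1}admissible0 -admissibleM.
by rewrite !admissible_lt// ltnW.
Qed.

Lemma admissible_itvcc i : (i <= M)%N -> x i \in `[a, b].
Proof.
move=> iM; case: (posnP i) => [->|i0].
  by rewrite admissible0 in_itv/= lexx ltW.
move: iM; rewrite leq_eqVlt => /predU1P[->|iM].
  by rewrite admissibleM in_itv/= lexx ltW.
by apply: subset_itv_oo_cc; apply: admissible_itvoo; rewrite i0.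
Qed.

Lemma Dh_gt0 k : (k < M)%N -> 0 < Dh a b M x k.
Proof. by move=> kM; rewrite divr_gt0 ?mesh_gt0// subr_gt0 admissible_lt. Qed.

Lemma Dtilde_gt0 i : (i <= M)%N -> 0 < Dtilde a b M x i.
Proof.
move=> iM; rewrite /Dtilde; have h0 := mesh_gt0.
case: eqVneq => [_|i0]; first by rewrite divr_gt0// subr_gt0 admissible_lt.
case: eqVneq => [_|neM].
  by rewrite divr_gt0// subr_gt0 admissible_lt// prednK.
have {}iM : (i < M)%N by rewrite ltn_neqAle neM.
apply: divr_gt0; last by rewrite mulr_gt0.
by rewrite subr_gt0 admissible_lt// prednK ?lt0n// leqnSn.
Qed.

End Admissible.

(** * Increments of the three energy terms over one step *)

Context (u0 : R -> R) (hu0 : forall z : R, z \in `[a, b] -> 0 < u0 z).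

Lemma at_nodes_gt0 i : (i <= M)%N -> 0 < at_nodes a b M u0 i.
Proof. by move=> iM; apply/hu0/grid_point_itv; rewrite ler0n ler_nat. Qed.

Lemma at_halves_gt0 k : (k < M)%N -> 0 < at_halves a b M u0 k.
Proof.
move=> kM; apply/hu0/grid_point_itv.
have : (k.+1%:R : R) <= M%:R by rewrite ler_nat.
have : (0 : R) <= k%:R by rewrite ler0n.
rewrite -natr1; lra.
Qed.

Context (x y : nat -> R).
Context (admx : admissible a b M x) (admy : admissible a b M y).

Lemma entropy_diff (H : R -> R) : positive_second_derivative H ->
  innerC a b M (fun k => H (at_halves a b M u0 k / Dh a b M y k)) (Dh a b M y) -
  innerC a b M (fun k => H (at_halves a b M u0 k / Dh a b M x k)) (Dh a b M x)
  <= innerE a b M (dh a b M (pressure a b M u0 H y)) (fun i => y i - x i).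
Proof.
move=> hH; rewrite -dh_by_parts ?(admissible0 admx) ?(admissible0 admy)
  ?(admissibleM admx) ?(admissibleM admy)//.
rewrite /innerC -mulrBr -mulrN ler_wpM2l ?(ltW mesh_gt0)// -sumrB -sumrN.
apply: ler_sum_nat => k /andP[_ kM].
have := perspective_tangent hH (at_halves_gt0 kM)
  (Dh_gt0 admy kM) (Dh_gt0 admx kM).
by rewrite /pressure; lra.
Qed.

(** Derivatives of the potentials and the scheme equation are available at interior nodes only; at
    the two end nodes the zero increment replaces them. *)
Lemma boundary_or_interior i : (i <= M)%N ->
  (0 < i < M)%N \/ x i = y i.
Proof.
move=> iM; case: (posnP i) => [->|i0]; first by right; rewrite !admissible0.
move: iM; rewrite leq_eqVlt => /predU1P[->|iM]; last by left.
by right; rewrite !admissibleM.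
Qed.

Lemma potential_diff (V Vc Ve : R -> R) :
  (forall z : R, z \in `[a, b] -> V z = Vc z - Ve z) ->
  convex_derivable a b Vc -> convex_derivable a b Ve ->
  innerE a b M (at_nodes a b M u0) (fun i => V (y i)) -
  innerE a b M (at_nodes a b M u0) (fun i => V (x i))
  <= innerE a b M (at_nodes a b M u0)
       (fun i => (derive1 Vc (y i) - derive1 Ve (x i)) * (y i - x i)).
Proof.
move=> hV hVc hVe; rewrite innerEB; apply: ler_innerE => i iM.
rewrite mulr1 -mulrBr ler_wpM2l ?(ltW (at_nodes_gt0 iM))//.
have [ii|->] := boundary_or_interior iM; last by rewrite !subrr mulr0.
have xi := admissible_itvcc admx iM; have yi := admissible_itvcc admy iM.
rewrite !hV//.
have := convex_tangent hVc (admissible_itvoo admy ii) xi.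
have := convex_tangent hVe (admissible_itvoo admx ii) yi.
lra.
Qed.

Lemma interaction_diff (W Wc We : R -> R) :
  (forall z : R, z \in `[a - b, b - a] -> W z = Wc z - We z) ->
  convex_derivable (a - b) (b - a) Wc -> convex_derivable (a - b) (b - a) We ->
  (forall z : R, z \in `[a - b, b - a] -> Wc (- z) = Wc z) ->
  (forall z : R, z \in `[a - b, b - a] -> We (- z) = We z) ->
  2^-1 * innerE a b M (at_nodes a b M u0)
      (fun i => innerE a b M (fun j => W (y i - y j)) (at_nodes a b M u0)) -
  2^-1 * innerE a b M (at_nodes a b M u0)
      (fun i => innerE a b M (fun j => W (x i - x j)) (at_nodes a b M u0))
  <= innerE a b M (at_nodes a b M u0)
      (fun i => (Shat a b M u0 Wc y i - Shat a b M u0 We x i) * (y i - x i)).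
Proof.
move=> hW hWc hWe eWc eWe.
pose c i := node_weight i * at_nodes a b M u0 i.
have c0 i : (i <= M)%N -> 0 < c i.
  by move=> iM; rewrite mulr_gt0 ?node_weight_gt0 ?at_nodes_gt0.
(* The convex part is differentiated at the new level and the concave part at the old one, matching
   the two [Shat] terms. *)
pose A i j := derive1 Wc (y i - y j) - derive1 We (x i - x j).
have cc z (adz : admissible a b M z) i j : (i <= M)%N -> (j <= M)%N ->
    z i - z j \in `[a - b, b - a].
  move=> iM jM; have := admissible_itvcc adz iM.
  have := admissible_itvcc adz jM.
  by rewrite !in_itv/=; lra.
have oo z (adz : admissible a b M z) i j : (0 < i < M)%N -> (j <= M)%N ->
    z i - z j \in `]a - b, b - a[.
  move=> iM jM; have := admissible_itvoo adz iM.
  have := admissible_itvcc adz jM.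
  by rewrite !in_itv/=; lra.
have oN r : r \in `]a - b, b - a[ -> - r \in `]a - b, b - a[.
  by rewrite !in_itv/=; lra.
have odd G : convex_derivable (a - b) (b - a) G ->
    (forall z : R, z \in `[a - b, b - a] -> G (- z) = G z) ->
    forall z, z \in `]a - b, b - a[ -> derive1 G (- z) = - derive1 G z.
  move=> [_ dG] eG z zab; have eab : a - b = - (b - a) by rewrite opprB.
  by apply: (@derive1_even _ (b - a)); rewrite -eab.
have Aanti i j : (i < M.+1)%N -> (j < M.+1)%N ->
    A j i * (y i - x i) = - (A i j * (y i - x i)).
  rewrite !ltnS => iM jM; have [ii|->] := boundary_or_interior iM; last first.
    by rewrite subrr !mulr0 oppr0.
  rewrite /A -(opprB (y i)) -(opprB (x i)) !odd ?oo//; ring.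
(* When i and j are both boundary indices, x i - x j may be an endpoint of
   [a - b, b - a], where the derivatives in A i j are junk; both increments
   then vanish. *)
have Adiff i j : (i <= M)%N -> (j <= M)%N ->
    W (y i - y j) - W (x i - x j) <= A i j * (y i - x i - (y j - x j)).
  move=> iM jM; rewrite !hW ?cc//.
  have [[yo xo]|[-> ->]] :
      ((y i - y j \in `]a - b, b - a[) /\ (x i - x j \in `]a - b, b - a[)) \/
      (x i = y i /\ x j = y j).
    have [ii|ei] := boundary_or_interior iM; first by left; rewrite !oo.
    have [jj|ej] := boundary_or_interior jM; last by right.
    by left; rewrite -(opprB (y j)) -(opprB (x j)) !oN ?oo.
  - have := convex_tangent hWc yo (cc _ admx _ _ iM jM).
    have := convex_tangent hWe xo (cc _ admy _ _ iM jM).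
    rewrite /A; lra.
  - by rewrite !subrr mulr0.
have -> : innerE a b M (at_nodes a b M u0)
      (fun i => (Shat a b M u0 Wc y i - Shat a b M u0 We x i) * (y i - x i)) =
    \sum_(0 <= i < M.+1)
      c i * ((\sum_(0 <= j < M.+1) c j * A i j) * (y i - x i)).
  rewrite innerE_sum; apply: eq_bigr => i _; rewrite mulrA; congr (_ * (_ * _)).
  rewrite /Shat !innerE_sum -sumrB; apply: eq_bigr => j _.
  rewrite /A /c; ring.
(* Read backwards, the symmetrization restores the factor [2^-1] and the differences of increments,
   which reduces the claim to [Adiff] for each pair of nodes. *)
rewrite -(antisymmetric_double_sum _ Aanti) -mulrBr.
rewrite ler_wpM2l ?invr_ge0 ?ler0n// innerEB innerE_sum.
apply: ler_sum_nat => i /andP[_ iM]; rewrite mulr1 -mulrBr mulrA.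
rewrite ler_wpM2l ?(ltW (c0 _ _))// !innerE_sum -sumrB.
apply: ler_sum_nat => j /andP[_ jM].
have := ler_wpM2l (ltW (c0 j jM)) (Adiff i j iM jM).
by rewrite /c; lra.
Qed.

End Grid.

(** * Combination of the increments with the scheme *)

Theorem theorem4p2 (R : realType) (a b : R) (hab : a < b)
    (M : nat) (hM : (0 < M)%N) (tau : R) (htau : 0 < tau)
    (u0 : R -> R) (hu0 : forall z : R, z \in `[a, b] -> 0 < u0 z)
    (H : R -> R) (hH : positive_second_derivative H)
    (f : R -> R) (hf : mobility f)
    (V Vc Ve : R -> R)
    (hV : forall z : R, z \in `[a, b] -> V z = Vc z - Ve z)
    (hVc : convex_derivable a b Vc) (hVe : convex_derivable a b Ve)
    (W Wc We : R -> R)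
    (hWlip : [lipschitz W z | z in [set` `[a - b, b - a]]])
    (hWeven : forall z : R, z \in `[a - b, b - a] -> W (- z) = W z)
    (hW : forall z : R, z \in `[a - b, b - a] -> W z = Wc z - We z)
    (hWc : convex_derivable (a - b) (b - a) Wc)
    (hWe : convex_derivable (a - b) (b - a) We)
    (* the splitting of W is into even functions; W_e is then even as well *)
    (hWceven : forall z : R, z \in `[a - b, b - a] -> Wc (- z) = Wc z)
    (x : nat -> nat -> R)
    (hx : scheme_solution a b M tau u0 H f Vc Ve Wc We x) (n : nat) :
  let E := energy a b M u0 H V W in
  let v := fun i : nat => (x n.+1 i - x n i) / tau in
  let dissipation :=
    innerE a b M (fun i => friction a b M u0 f (x n) i * v i) v in
  (E (x n.+1) - E (x n)) / tau <= - dissipation /\ - dissipation <= 0.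
Proof.
move=> E v dissipation.
have [_ adm step] := hx.
have admx := adm n; have admy := adm n.+1.
split; last first.
  rewrite oppr_le0 /dissipation innerE_sum// big_nat_cond; apply: sumr_ge0.
  move=> i /andP[/andP[_ iM] _].
  rewrite mulr_ge0 ?(ltW (node_weight_gt0 _ _ _))//.
  have u0i := at_nodes_gt0 hab hM hu0 iM; have Di := Dtilde_gt0 hab hM admx iM.
  rewrite -mulrA -expr2 mulr_ge0 ?sqr_ge0// mulr_ge0//.
    by rewrite divr_ge0 ?sqr_ge0// ltW.
  (* The inverse keeps the sign of [f], the inverse of 0 being 0. *)
  rewrite invr_ge0; case: hf => f0 _ _ _ _.
  by apply: f0; rewrite ltW// divr_gt0.
have hWe' (z : R) : z \in `[a - b, b - a] -> We (- z) = We z.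
  move=> zab; have nzab : - z \in `[a - b, b - a].
    by move: zab; rewrite !in_itv/=; lra.
  by have := hWeven _ zab; rewrite !hW// hWceven//; lra.
have dH := entropy_diff hab hM hu0 admx admy hH.
have dV := potential_diff hab hM hu0 admx admy hV hVc hVe.
have dW := interaction_diff hab hM hu0 admx admy hW hWc hWe hWceven hWe'.
rewrite ler_pdivrMr//.
have : E (x n.+1) - E (x n) <=
    innerE a b M (dh a b M (pressure a b M u0 H (x n.+1)))
       (fun i => x n.+1 i - x n i) +
    innerE a b M (at_nodes a b M u0)
       (fun i => (derive1 Vc (x n.+1 i) - derive1 Ve (x n i)) *
                 (x n.+1 i - x n i)) +
    innerE a b M (at_nodes a b M u0)
      (fun i => (Shat a b M u0 Wc (x n.+1) i - Shat a b M u0 We (x n) i) *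
                (x n.+1 i - x n i)).
  by rewrite /E /energy; lra.
(* What remains is an equality: the bound just obtained is [- dissipation * tau], checked node by
   node. *)
move/le_trans; apply; rewrite le_eqVlt; apply/orP; left; apply/eqP.
rewrite !innerED// mulrC mulrN -mulNr /dissipation !innerE_sum// mulr_sumr.
apply: eq_big_nat => i /andP[_ iM].
(* At an end node both sides are zero; at an interior node the scheme replaces the friction term. *)
have [ii|ei] := boundary_or_interior hM admx admy iM; last first.
  by rewrite /v ei subrr; ring.
have range : (1 <= i <= M.-1)%N.
  by case/andP: ii => -> ltiM /=; rewrite -(leq_add2r 1) !addn1 prednK.
have := step n i range; rewrite /= -/(v i) => ->.
have -> : x n.+1 i - x n i = tau * v i by rewrite /v; field; rewrite gt_eqF.
ring.
Qed.
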